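(* Let $n\ge 1$ be an integer. If $D$ is a digraph with $\vec{\chi}(D) \ge 22n$, then $D$ contains (as a subdigraph) a subdivision of every subcubic digraph on at most $n$ vertices.
   Context: All graphs and digraphs are finite; undirected graphs are simple, digraphs have no loops and no parallel arcs, but may contain both arcs $(u,v)$ and $(v,u)$. For a digraph $D$, the dichromatic number $\vec{\chi}(D)$ is the minimum $k$ such that $V(D)$ can be colored with $k$ colors so that every color class induces an acyclic subdigraph (one without directed cycles; two opposite arcs between the same two vertices form a directed cycle of length 2). A digraph is called subcubic if it is an orientation of an undirected graph with maximum degree at most three (each edge receives exactly one of its two directions) such that the in-degree and the out-degree of every vertex are each at most two. A subdivision of a digraph $H$ is any digraph obtained from $H$ by replacing every arc $(u,v)$ of $H$ by a directed path from $u$ to $v$, such that the subdivision paths of different arcs are internally vertex-disjoint (the internal vertices of these paths being new vertices not in $V(H)$; a path may consist of the single arc $(u,v)$). *)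

(* Defs.v *)
From mathcomp Require Import all_boot.

Set Implicit Arguments.
Unset Strict Implicit.
Unset Printing Implicit Defensive.

Record digraph := Digraph {
  vertex :> finType;
  arc : rel vertex;
  arc_irrefl : irreflexive arc
}.
Arguments arc {d}.

Definition dicycle (D : digraph) (c : seq D) : bool :=
  [&& 0 < size c, uniq c & cycle arc c].

(* The subdigraph of D induced by S is acyclic. Since the vertices of a
   directed cycle are distinct, bounding its length by #|D| loses nothing
   (see acyclicP) and makes the predicate boolean. *)
Definition acyclic (D : digraph) (S : {set D}) : bool :=
  [forall k : 'I_#|D|.+1, forall c : k.-tuple D,
     dicycle c ==> ~~ all [in S] c].

Lemma acyclicP (D : digraph) (S : {set D}) :
  reflect (forall c : seq D, dicycle c -> ~ {subset c <= S}) (acyclic S).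
Proof.
apply: (iffP idP) => [acS c cyc cS | H].
- have sz : size c < #|D|.+1.
    by case/and3P: cyc => _ u _; rewrite ltnS -(card_uniqP u) max_card.
  move/forallP/(_ (Ordinal sz))/forallP/(_ (in_tuple c)): acS.
  by rewrite cyc /= => /negP; apply; apply/allP.
- apply/forallP => k; apply/forallP => c; apply/implyP => cyc.
  by apply/negP => /allP; apply: H.
Qed.

Definition dicolorable (D : digraph) (k : nat) : bool :=
  [exists col : {ffun D -> 'I_k},
     [forall i : 'I_k, acyclic [set x | col x == i]]].

Lemma dicolorable_card (D : digraph) : dicolorable D #|D|.
Proof.
apply/existsP; exists [ffun x => enum_rank x]; apply/forallP => i.
apply/acyclicP => -[//|x [|y c]] /and3P [_ u cyc] sub.
- by move: cyc; rewrite /= arc_irrefl.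
- have := sub x (mem_head _ _).
  have := sub y; rewrite inE mem_head orbT => /(_ isT).
  rewrite !inE !ffunE => /eqP <- /eqP /enum_rank_inj xy.
  by move: u; rewrite xy /= mem_head.
Qed.

Lemma dicolorable_ex (D : digraph) : exists k, dicolorable D k.
Proof. by exists #|D|; exact: dicolorable_card. Qed.

Definition dichromatic_number (D : digraph) : nat :=
  ex_minn (dicolorable_ex D).

(* D is obtained by giving each edge of the graph e exactly one of its two
   directions. *)
Definition orientation_of (D : digraph) (e : rel D) : Prop :=
  (forall u v : D, arc u v -> e u v) /\
  (forall u v : D, e u v -> arc u v (+) arc v u).

Definition subcubic (D : digraph) : Prop :=
  (exists e : rel D,
     [/\ symmetric e, irreflexive e,
         forall v : D, #|[set u | e v u]| <= 3
       & orientation_of e]) /\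
  (forall v : D, #|[set u | arc u v]| <= 2 /\ #|[set u | arc v u]| <= 2).

(* S is a subdivision of H: f embeds V(H) into V(S), and for an arc (u, v) of
   H the list P u v contains, in order, the internal vertices of the path
   replacing (u, v); the values of P at non-arcs are irrelevant. The last two
   conditions say that S has no vertices and no arcs besides those of H (as
   vertices) and of the paths; in particular consecutive vertices of
   f u :: rcons (P u v) (f v) are joined by an arc of S. *)
Definition subdivision_of (H S : digraph) : Prop :=
  exists (f : H -> S) (P : H -> H -> seq S),
  [/\ injective f,
      forall u v, arc u v ->
        uniq (f u :: rcons (P u v) (f v)) /\
        (forall x, x \in P u v -> x \notin codom f),
      forall u v u' v', arc u v -> arc u' v' -> (u, v) <> (u', v') ->
        forall x, x \in P u v -> x \notin P u' v',
      forall x : S,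
        x \in codom f \/ exists u v, arc u v /\ x \in P u v
    & forall x y : S, arc x y <->
        exists u v, arc u v /\
          (x, y) \in zip (f u :: P u v) (rcons (P u v) (f v))].

(* S is isomorphic to a (not necessarily induced) subdigraph of D. *)
Definition contains (D S : digraph) : Prop :=
  exists g : S -> D,
    injective g /\ forall x y : S, arc x y -> arc (g x) (g y).

Definition contains_subdivision (D H : digraph) : Prop :=
  exists S : digraph, subdivision_of H S /\ contains D S.

(* Main.v *)
From mathcomp Require Import all_boot.
From mathcomp Require Import zify.
Require Import Defs.

Set Implicit Arguments.
Unset Strict Implicit.
Unset Printing Implicit Defensive.

(** Call two disjoint strongly connected vertex sets adjacent when D has arcs
    between them in both directions. Repeatedly removing a maximal strongly
    connected 2-dicolorable set partitions V(D) so that every pairwise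
    nonadjacent subfamily has a 2-dicolorable union: a monochromatic cycle
    would give an ear of some part, and a shortest such ear, colored
    alternately, could be added to that part. Hence this adjacency graph has
    chromatic number at least 11n, and some subfamily has minimum degree at
    least 11n-1.

    Among the families of average degree at least 11n-1 take a smallest one.
    Contracting an edge destroys the density, so every edge lies in many
    triangles, and the neighborhood S of a vertex of minimum degree satisfies
    |S| <= 2 delta + 1 with 2 delta >= 11n-2 for its minimum degree delta. In S
    place V(H) so that as many arcs of H as possible become edges; then each
    vertex of H is on at most two of the other arcs, so there are at most n of
    them, and they are routed greedily with at most two internal vertices each.
    If this gets stuck, S contains two large sets without edges between them,
    and any two elements of one of these have at least 5n/2 common neighbors,
    which allows routing every arc of H through a single vertex.

    As adjacency is bidirectional, the branch sets of this minor have strongly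
    connected unions, and as H is subcubic, each of these contains a center
    with disjoint paths to or from the at most three required endpoints. *)

(** * Relations restricted to a set *)

Section Relations.

Variable T : finType.
Implicit Types (r : rel T) (A B Q X : {set T}).

Definition rel_in r B : rel T := fun x y => [&& x \in B, y \in B & r x y].

Definition converse r : rel T := fun x y => r y x.

Definition strongly_connected r B :=
  [forall x in B, forall y in B, connect (rel_in r B) x y].

Lemma strongly_connectedP r B :
  reflect {in B &, forall x y, connect (rel_in r B) x y}
          (strongly_connected r B).
Proof.
apply: (iffP forall_inP) => [h x y xB yB | h x xB].
  by have /forall_inP := h x xB; apply.
by apply/forall_inP => y; apply: h.
Qed.

Lemma connect_rel_in_sub r A B :
  A \subset B -> subrel (connect (rel_in r A)) (connect (rel_in r B)).
Proof.
move=> /subsetP sAB; apply: connect_sub => x y /and3P[xA yA rxy].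
by apply: connect1; apply/and3P; split=> //; apply: sAB.
Qed.

Lemma rel_in_converse r B : rel_in (converse r) B =2 converse (rel_in r B).
Proof. by move=> x y; rewrite /rel_in /converse andbCA. Qed.

Lemma connect_converse r B x y :
  connect (rel_in (converse r) B) x y = connect (rel_in r B) y x.
Proof.
rewrite (eq_connect (rel_in_converse r B)).
exact: (connect_rev (rel_in r B) x y).
Qed.

Lemma strongly_connected_converse r B :
  strongly_connected (converse r) B = strongly_connected r B.
Proof.
apply/strongly_connectedP/strongly_connectedP => h x y xB yB.
  by rewrite -connect_converse h.
by rewrite connect_converse h.
Qed.

Lemma strongly_connected1 r x : strongly_connected r [set x].
Proof. by apply/strongly_connectedP => y z /set1P-> /set1P->; apply: connect0. Qed.

Lemma path_rel_in r B x s : x \in B ->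
  reflect (path r x s /\ {subset s <= B}) (path (rel_in r B) x s).
Proof.
move=> xB; apply: (iffP idP).
  elim: s x xB => [|y s IH] x xB //= /andP[/and3P[_ yB rxy] ps].
  have [-> sB] := IH y yB ps; rewrite rxy; split=> // z.
  by rewrite inE => /predU1P[->|/sB].
elim: s x xB => [|y s IH] x xB //= [/andP[rxy ps] sB].
have yB : y \in B by apply: sB; rewrite mem_head.
apply/andP; split; first by apply/and3P.
apply/(IH y yB); split=> // z zs.
by apply: sB; rewrite inE zs orbT.
Qed.

Lemma strongly_connectedU r A B x y x' y' :
  strongly_connected r A -> strongly_connected r B ->
  x \in A -> y \in B -> r x y -> x' \in A -> y' \in B -> r y' x' ->
  strongly_connected r (A :|: B).
Proof.
move=> /strongly_connectedP cA /strongly_connectedP cB xA yB rxy xA' yB' ryx.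
set C := connect (rel_in r (A :|: B)).
have sA u v : u \in A -> v \in A -> C u v.
  by move=> uA vA; apply: connect_rel_in_sub (cA u v uA vA); apply: subsetUl.
have sB u v : u \in B -> v \in B -> C u v.
  by move=> uB vB; apply: connect_rel_in_sub (cB u v uB vB); apply: subsetUr.
have xy : C x y by apply: connect1; rewrite /rel_in !inE xA yB rxy orbT.
have yx : C y' x' by apply: connect1; rewrite /rel_in !inE xA' yB' ryx orbT.
have AB u v : u \in A -> v \in B -> C u v.
  move=> uA vB; apply: connect_trans (sA u x uA xA) _.
  exact: connect_trans xy (sB _ _ yB vB).
have BA u v : u \in B -> v \in A -> C u v.
  move=> uB vA; apply: connect_trans (sB u y' uB yB') _.
  exact: connect_trans yx (sA _ _ xA' vA).
apply/strongly_connectedP => u v /setUP[uA|uB] /setUP[vA|vB];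
  by [apply: sA | apply: sB | apply: AB | apply: BA].
Qed.

(** Cut the walk just after its last vertex in [X]; the remainder never leaves [Q]. *)
Lemma last_exit r X Q x q :
  [disjoint X & Q] -> connect (rel_in r (X :|: Q)) x q -> x \in X -> q \in Q ->
  exists x' p, [/\ x' \in X, p \in Q, r x' p & connect (rel_in r Q) p q].
Proof.
move=> dXQ /connectP[s ps e] xX qQ.
have: x \in Q /\ connect (rel_in r Q) x q \/ exists x' p,
    [/\ x' \in X, p \in Q, r x' p & connect (rel_in r Q) p q].
  elim: s x {xX} ps e => [|y s IH] x /= => [_ <-|]; first by left.
  case/andP=> /and3P[xXQ _ rxy] ps e.
  case: (IH y ps e) => [[yQ yq]|h]; last by right.
  case/setUP: xXQ => [xX|xQ]; first by right; exists x, y.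
  left; split=> //; apply: connect_trans yq.
  by apply: connect1; rewrite /rel_in xQ yQ.
by case=> // -[xQ _]; rewrite (disjointFr dXQ xX) in xQ.
Qed.

End Relations.

(** * Ears and 2-dicolorings *)

Section Decomposition.

Variable D : digraph.
Implicit Types (B X Q W : {set D}) (c : D -> bool).

Definition two_dicolorable B :=
  [exists c : {ffun D -> bool},
     [forall b, acyclic [set x in B | c x == b]]].

Lemma two_dicolorableP B :
  reflect (exists c, forall z b, dicycle z -> {subset z <= B} ->
             ~ {in z, forall x, c x = b})
          (two_dicolorable B).
Proof.
apply: (iffP existsP) => [[c /forallP h]|[c h]].
  exists c => z b cz zB zb; move/acyclicP: (h b) => /(_ z cz); apply.
  by move=> x xz; rewrite inE zB //= zb.
exists (finfun c); apply/forallP=> b; apply/acyclicP=> z cz zB.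
apply: (h z b cz) => x /zB; rewrite inE => /andP[//].
by rewrite ffunE => _ /eqP.
Qed.

Lemma two_dicolorable1 x : two_dicolorable [set x].
Proof.
apply/two_dicolorableP; exists (fun=> true) => z b /and3P[z0 uz cz] zx _.
case: z z0 uz cz zx => // y [|y' z] _ uz /= cz zx.
  by rewrite arc_irrefl in cz.
have /set1P ey := zx y (mem_head _ _).
have /set1P ey' : y' \in [set x] by apply: zx; rewrite !inE eqxx orbT.
by move: uz; rewrite ey ey' /= mem_head.
Qed.

Lemma cycle_connect (z : seq D) B x y : cycle arc z -> {subset z <= B} ->
  x \in z -> y \in z -> connect (rel_in arc B) x y.
Proof.
move=> cz zB xz yz.
case/rot_to: (xz) => i s ez.
have cxs : cycle arc (x :: s) by rewrite -ez rot_cycle.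
have mz : z =i x :: s by move=> w; rewrite -ez mem_rot.
move: cxs => /=; rewrite rcons_path => /andP[ps _].
apply: (@path_connect _ (rel_in arc B) x s); last by rewrite -mz.
apply/path_rel_in; first exact: zB.
by split=> // w ws; apply: zB; rewrite mz inE ws orbT.
Qed.

(* The sequence s has no forward chords and touches X only at its ends, so a
   monochromatic cycle for the alternating coloring of s follows s backwards
   and cannot enter s from X. *)
Lemma two_dicolorableU_path X (s : seq D) p :
  [disjoint X & s] -> uniq s -> 1 < size s ->
  (forall i, i < size s -> [exists x in X, arc x (nth p s i)] -> i = 0) ->
  (forall i, i < size s -> [exists x in X, arc (nth p s i) x] ->
     i = (size s).-1) ->
  (forall i j, i < size s -> j < size s ->
     arc (nth p s i) (nth p s j) -> j <= i.+1) ->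
  two_dicolorable X -> two_dicolorable (X :|: [set y in s]).
Proof.
move=> disXs us two_s s_start s_end s_chord.
move=> /two_dicolorableP[c hc]; apply/two_dicolorableP.
pose col x := if x \in X then c x else odd (index x s).
exists col => z b cz zXs mono; case/and3P: (cz) => z0 uz cycz.
have [/allP zX|] := boolP (all [in X] z).
  by apply: (hc z b cz zX) => x xz; rewrite -(mono x xz) /col zX.
have sX x : x \in s -> (x \in X) = false.
  by move=> xs; rewrite (disjointFl disXs xs).
pose bad i := (i < size s) && (nth p s i \in z).
have badP x : x \in z -> x \notin X -> bad (index x s).
  move=> xz xX; have := zXs x xz; rewrite in_setU (negbTE xX) [_ \in [set _ in s]]inE.
  by move=> xs; apply/andP; rewrite index_mem nth_index.
have badcol i : bad i -> odd i = b.
  case/andP=> li iz; rewrite -(mono _ iz) /col sX ?mem_nth //.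
  by rewrite index_uniq.
rewrite -has_predC => /hasP[x xz xX].
(* Let [i] be the first position of [s] visited by the cycle. *)
case: (ex_minnP (ex_intro bad _ (badP x xz xX))) => i badi mini.
have [li iz] := andP badi.
(* A successor on [s] would be at position [i.+1], by minimality and the lack of forward chords,
   where the color differs. So the successor is in [X] and [s_end] applies. *)
have iE : i = (size s).-1.
  have nz : next z (nth p s i) \in z by rewrite mem_next.
  have ar := next_cycle cycz iz.
  case: (boolP (next z (nth p s i) \in X)) => [nX|/(badP _ nz) badj].
    by apply: s_end => //; apply/existsP; exists (next z (nth p s i)); rewrite nX.
  have [lj jz] := andP badj.
  move: (next z (nth p s i)) ar nz badj lj jz (mini _ badj) => y ar yz badj lj jz lij.
  have ys : y \in s by rewrite -index_mem.
  have := s_chord i (index y s) li lj; rewrite nth_index // => /(_ ar) lji.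
  have: index y s != i.
    by apply: contraTneq ar => <-; rewrite nth_index // arc_irrefl.
  move=> nji; have ej : index y s = i.+1.
    by move: lij lji nji; move: (index y s) => j; clear; lia.
  by move: (badcol _ badj); rewrite ej /= (badcol _ badi); case: (b).
(* A predecessor in [X] would force the last position to be 0; one on [s] could only be at position
   [i] itself, giving a loop. *)
have pz : prev z (nth p s i) \in z by rewrite mem_prev.
have ar := prev_cycle cycz iz.
case: (boolP (prev z (nth p s i) \in X)) => [pX|/(badP _ pz) badj].
  have i0 : i = 0.
    by apply: s_start => //; apply/existsP; exists (prev z (nth p s i)); rewrite pX.
  by move: iE two_s; rewrite i0; clear; case: (size s) => // -[].
have [lj jz] := andP badj.
move: (prev z (nth p s i)) ar pz badj lj jz (mini _ badj) => y ar yz badj lj jz lij.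
have ys : y \in s by rewrite -index_mem.
have ej : index y s = i.
  by apply/eqP; rewrite eqn_leq lij andbT iE -ltnS prednK // ltnW.
by move: ar; rewrite -ej nth_index // arc_irrefl.
Qed.

(** [s] lists only the inner vertices; the two ends in [X] stay implicit and may coincide. *)
Definition ear X Q (s : seq D) :=
  if s is p :: s' then
    [&& all [in Q] s, path arc p s',
        [exists x in X, arc x p] & [exists x in X, arc (last p s') x]]
  else false.

Lemma shortest_ear X Q s0 : ear X Q s0 ->
  exists2 s, ear X Q s & forall s', ear X Q s' -> size s <= size s'.
Proof.
pose P k := [exists t : k.-tuple D, ear X Q t].
have exP s : ear X Q s -> P (size s).
  by move=> es; apply/existsP; exists (in_tuple s).
move=> /exP e0; case: (ex_minnP (ex_intro P _ e0)) => k /existsP[t et] mink.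
exists t => // s' /exP; rewrite size_tuple; exact: mink.
Qed.

(** * Shortest ears *)

Section ShortestEar.

Variables (X Q : {set D}) (p : D) (s' : seq D).
Let s := p :: s'.
Hypothesis (es : ear X Q s).
Hypothesis min_s : forall t, ear X Q t -> size s <= size t.

Let sQ : {subset s <= Q}. Proof. by case/and4P: es => /allP. Qed.
Let pth : path arc p s'. Proof. by case/and4P: es. Qed.

(** Otherwise dropping the first [i] vertices leaves a shorter ear. *)
Lemma ear_start i : i < size s -> [exists x in X, arc x (nth p s i)] -> i = 0.
Proof.
move=> lis Xi; case/and4P: es => aQ _ _ lX.
have e : drop i s = nth p s i :: drop i.+1 s by rewrite (drop_nth p).
have : ear X Q (drop i s).
  rewrite e; apply/and4P; split=> //.
  - rewrite -e; apply/allP=> y /mem_drop; exact: sQ.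
  - by have : sorted arc (drop i s) by [exact: drop_sorted]; rewrite e.
  - suff -> : last (nth p s i) (drop i.+1 s) = last p s' by [].
    rewrite -[last p s']/(last p s) -{3}(cat_take_drop i s) last_cat.
    by rewrite e.
by move/min_s; rewrite size_drop; lia.
Qed.

Lemma ear_end i : i < size s -> [exists x in X, arc (nth p s i) x] ->
  i = (size s).-1.
Proof.
move=> lis Xi; case/and4P: es => aQ _ sX _.
have : ear X Q (take i.+1 s).
  change (ear X Q (p :: take i s')); apply/and4P; split=> //.
  - by apply/allP=> y /predU1P[->|/mem_take ys]; apply: sQ; rewrite !inE ?eqxx ?ys ?orbT.
  - exact: take_path.
  - suff -> : last p (take i s') = nth p s i by [].
    by rewrite (last_nth p) size_takel // -[p :: take i s']/(take i.+1 s) nth_take.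
by move/min_s; move: lis; rewrite /s /= => lis; rewrite size_takel; lia.
Qed.

(** A longer chord would bypass the vertices between its ends and give a shorter ear. *)
Lemma ear_chord i j : i < size s -> j < size s ->
  arc (nth p s i) (nth p s j) -> j <= i.+1.
Proof.
move=> lis ljs aij; rewrite leqNgt; apply/negP=> lij.
case/and4P: es => aQ _ sX lX.
have e : drop j s = nth p s j :: drop j.+1 s by rewrite (drop_nth p).
have : ear X Q (take i.+1 s ++ drop j s).
  change (ear X Q (p :: (take i s' ++ drop j s))); apply/and4P; split=> //.
  - apply/allP=> y; rewrite -cat_cons mem_cat -[p :: take i s']/(take i.+1 s).
    by case/orP=> [/mem_take|/mem_drop]; apply: sQ.
  - rewrite cat_path take_path //= e /=.
    have -> : last p (take i s') = nth p s i.
      by rewrite (last_nth p) size_takel // -[p :: take i s']/(take i.+1 s) nth_take.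
    rewrite aij /=.
    by have : sorted arc (drop j s) by [exact: drop_sorted]; rewrite e.
  - suff -> : last p (take i s' ++ drop j s) = last p s' by [].
    rewrite last_cat -[last p s']/(last p s) -{2}(cat_take_drop j s) last_cat e.
    by [].
move/min_s; move: lis ljs; rewrite /s => lis ljs.
by rewrite [size (_ :: _ ++ _)]/= size_cat size_takel // size_drop; move: lis ljs => /=; lia.
Qed.

Hypothesis disXQ : [disjoint X & Q].
Hypothesis two_s : 1 < size s.

(** If positions [i < j] agree, what leaves [j] also leaves [i]: a forward chord, or, for the last
    [j], an arc into [X] that [ear_end] forbids at [i]. *)
Lemma ear_uniq : uniq s.
Proof.
rewrite -[uniq s]negbK; apply/negP => /(uniqPn p)[i [j [lij lj e]]].
have li : i < size s by exact: ltn_trans lij lj.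
case: (eqVneq j (size s).-1) => [ej|nj].
  have : i = (size s).-1.
    apply: ear_end => //; rewrite e ej nth_last /=.
    by case/and4P: es.
  lia.
have lj1 : j.+1 < size s by move: lj nj; move: (size s) => k; lia.
have : arc (nth p s i) (nth p s j.+1).
  by rewrite e; move/(pathP p): pth; apply.
by move/(ear_chord li lj1); lia.
Qed.

Lemma ear_two_dicolorable : two_dicolorable X ->
  two_dicolorable (X :|: [set y in s]).
Proof.
apply: (@two_dicolorableU_path _ _ p).
- by apply: disjointWr disXQ; apply/subsetP.
- exact: ear_uniq.
- exact: two_s.
- exact: ear_start.
- exact: ear_end.
- exact: ear_chord.
Qed.

Lemma ear_strongly_connected : strongly_connected arc X ->
  strongly_connected arc (X :|: [set y in s]).
Proof.
move=> cX; case/and4P: es => _ _ /exists_inP[x xX xp] /exists_inP[y yX ly].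
move/strongly_connectedP: cX => cX.
set C := connect (rel_in arc (X :|: [set y in s])).
have sX u v : u \in X -> v \in X -> C u v.
  by move=> uX vX; apply: connect_rel_in_sub (cX u v uX vX); apply: subsetUl.
have inX w : w \in X -> w \in X :|: [set y in s] by move=> wX; rewrite inE wX.
have ins w : w \in s -> w \in X :|: [set y in s].
  by move=> ws; rewrite !inE; move: ws; rewrite inE => ->; rewrite orbT.
have ps : path (rel_in arc (X :|: [set y in s])) p s'.
  apply/path_rel_in; first by apply: ins; rewrite mem_head.
  by split=> // w ws; apply: ins; rewrite inE ws orbT.
have to_s w : w \in s -> C x w.
  move=> ws; apply: (connect_trans (y := p)); last by apply: (path_connect ps).
  by apply: connect1; apply/and3P; split=> //; [exact: inX | apply: ins; rewrite mem_head].
have from_s w : w \in s -> C w y.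
  move=> ws; apply: (connect_trans (y := last p s')).
    case/splitPl: ws ps => s1 s2 <-; rewrite cat_path last_cat => /andP[_ ps2].
    by apply/connectP; exists s2.
  apply: connect1; apply/and3P; split=> //; [| exact: inX].
  by apply: ins; rewrite mem_last.
apply/strongly_connectedP => u v; rewrite !in_setU ![_ \in [set _ in s]]inE.
case/orP=> [uX|us] /orP[vX|vs].
- exact: sX.
- exact: connect_trans (sX _ _ uX xX) (to_s _ vs).
- exact: connect_trans (from_s _ us) (sX _ _ yX vX).
- apply: connect_trans (from_s _ us) _.
  exact: connect_trans (sX _ _ yX xX) (to_s _ vs).
Qed.

End ShortestEar.

(** A shortest ear with one vertex contradicts the hypothesis on arcs, a longer one the maximality
    of [X]. Without ears no cycle meets both [X] and [Q], so the two colorings can be glued. *)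
Lemma two_dicolorableU X Q :
  [disjoint X & Q] -> strongly_connected arc X -> two_dicolorable X ->
  (forall p, p \in Q -> [exists x in X, arc x p] ->
     ~~ [exists x in X, arc p x]) ->
  (forall X', X \proper X' -> X' \subset X :|: Q ->
     strongly_connected arc X' -> ~~ two_dicolorable X') ->
  two_dicolorable Q -> two_dicolorable (X :|: Q).
Proof.
move=> dXQ cX tX noQ maxX /two_dicolorableP[cQ hQ].
have no_ear s : ~~ ear X Q s.
  apply/negP => /shortest_ear[{}s es min_s].
  case: s es min_s => // p s es min_s.
  case: s es min_s => [|y s] es min_s.
    case/and4P: (es) => /allP sQ _ Xp pX.
    by move: (noQ p (sQ _ (mem_head _ _)) Xp); rewrite pX.
  have sQ : [set z in p :: y :: s] \subset Q.
    by apply/subsetP => z; rewrite inE; case/and4P: es => /allP sQ _ _ _; apply: sQ.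
  have pX : p \notin X.
    have pQ : p \in Q by apply: (subsetP sQ); rewrite inE mem_head.
    by rewrite (disjointFl dXQ pQ).
  have := ear_two_dicolorable es min_s dXQ isT tX.
  apply/negP; apply: maxX.
  - apply/properP; split; first exact: subsetUl.
    by exists p => //; rewrite inE [X in _ || X]inE mem_head orbT.
  - exact: setUS sQ.
  - exact: (ear_strongly_connected es cX).
have [cX' hX] := two_dicolorableP _ tX.
apply/two_dicolorableP; exists (fun x => if x \in X then cX' x else cQ x).
move=> z b cz zXQ mono; case/and3P: (cz) => z0 uz cycz.
have [/allP zX|/allPn[q qz qX]] := boolP (all [in X] z).
  by apply: (hX z b cz zX) => x xz; rewrite -(mono x xz) zX.
have qQ : q \in Q by have := zXQ q qz; rewrite inE (negbTE qX).
have [/hasP[x xz xX]|/hasPn zX] := boolP (has [in X] z); last first.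
  apply: (hQ z b cz) => [x xz|x xz].
    by have := zXQ x xz; rewrite inE (negbTE (zX x xz)).
  by rewrite -(mono x xz) (negbTE (zX x xz)).
(* The last exit from [X] towards [q] starts an ear; the last exit in the converse digraph ends
   it. *)
have [x1 [p1 [x1X p1Q xp1 c1]]] :=
  last_exit dXQ (cycle_connect cycz zXQ xz qz) xX qQ.
have := cycle_connect cycz zXQ qz xz; rewrite -connect_converse => cqx.
have [x2 [p2 [x2X p2Q xp2]]] := last_exit dXQ cqx xX qQ.
rewrite connect_converse => c2.
have /connectP[s ps e2] := connect_trans c1 c2.
have [ps1 sQ] := path_rel_in _ _ p1Q ps.
apply: (negP (no_ear (p1 :: s))); apply/and4P; split=> //.
- by apply/allP => y; rewrite inE => /predU1P[->|/sQ].
- by apply/existsP; exists x1; rewrite x1X.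
- by apply/existsP; exists x2; rewrite x2X -e2.
Qed.

End Decomposition.

(** * Decomposition into strongly connected sets *)

Definition biadjacent (T : finType) (r : rel T) : rel {set T} := fun X Y =>
  [&& X != Y, [exists x in X, exists y in Y, r x y]
            & [exists x in X, exists y in Y, r y x]].

Lemma biadjacentP (T : finType) (r : rel T) (X Y : {set T}) :
  reflect [/\ X != Y, exists x y, [/\ x \in X, y \in Y & r x y]
                    & exists x y, [/\ x \in X, y \in Y & r y x]]
          (biadjacent r X Y).
Proof.
apply: (iffP and3P) => -[ne h h']; split=> //.
- by case/exists_inP: h => x xX /exists_inP[y yY rxy]; exists x, y.
- by case/exists_inP: h' => x xX /exists_inP[y yY rxy]; exists x, y.
- by case: h => x [y [xX yY rxy]]; apply/exists_inP; exists x => //; apply/exists_inP; exists y.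
- by case: h' => x [y [xX yY rxy]]; apply/exists_inP; exists x => //; apply/exists_inP; exists y.
Qed.

Lemma biadjacent_sym (T : finType) (r : rel T) : symmetric (biadjacent r).
Proof.
move=> X Y; apply/biadjacentP/biadjacentP => -[ne [x [y [? ? ?]]] [x' [y' [? ? ?]]]];
  by split; [rewrite eq_sym | exists y', x' | exists y, x].
Qed.

Lemma biadjacent_irrefl (T : finType) (r : rel T) : irreflexive (biadjacent r).
Proof. by move=> X; apply/and3P => -[]; rewrite eqxx. Qed.

(** Greedy coloring: a vertex of degree below [k] is removed, and later receives a color missing
    among its neighbors. *)
Lemma degenerate_coloring (T : finType) (e : rel T) (k : nat) (S : {set T}) :
  symmetric e -> irreflexive e ->
  (forall R : {set T}, R \subset S -> R != set0 ->
     exists2 x, x \in R & #|[set y in R | e x y]| < k) ->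
  exists g : T -> nat, {in S, forall x, g x < k} /\
    {in S &, forall x y, e x y -> g x != g y}.
Proof.
move=> sym_e irr_e; have [m] := ubnP #|S|; elim: m S => // m IH S ltSm degS.
have [->|nS] := eqVneq S set0; first by exists (fun=> 0); split=> x; rewrite inE.
have [x xS dx] := degS S (subxx _) nS.
have [||g [gk gP]] := IH (S :\ x).
- by move: ltSm; rewrite (cardsD1 x) xS; lia.
- by move=> R RS; apply: degS; apply: subset_trans RS (subsetDl _ _).
pose s := [seq g y | y <- enum [set y in S | e x y]].
have : ~~ all (fun i => i \in s) (iota 0 k).
  apply/negP=> /allP sub; have := uniq_leq_size (iota_uniq 0 k) sub.
  by rewrite size_iota size_map -cardE leqNgt dx.
case/allPn => i; rewrite mem_iota add0n /= => ik iNs.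
have iN y : y \in S -> e x y -> i != g y.
  move=> yS xy; apply: contra iNs => /eqP->; apply: map_f.
  by rewrite mem_enum inE yS.
exists (fun y => if y == x then i else g y); split.
  by move=> y yS; case: (eqVneq y x) => // nyx; apply: gk; rewrite !inE nyx.
move=> y z yS zS; case: (eqVneq y x) => [->|nyx]; case: (eqVneq z x) => [->|nzx] yz.
- by rewrite irr_e in yz.
- exact: iN.
- by rewrite eq_sym iN // sym_e.
- by apply: gP; rewrite ?inE ?nyx ?nzx.
Qed.

(** * Branch families and dense subfamilies *)

Section Families.

Variable D : digraph.
Implicit Types (W X Y : {set D}) (P I R : {set {set D}}).

(** The empty set passes as strongly connected, so it is excluded separately. *)
Definition branch_family P :=
  [&& trivIset P, set0 \notin P & [forall X in P, strongly_connected arc X]].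

Lemma two_dicolorable_decomposition W :
  exists P, [/\ branch_family P, cover P = W &
    forall I, I \subset P -> {in I &, forall X Y, ~~ biadjacent arc X Y} ->
      two_dicolorable (cover I)].
Proof.
have [m] := ubnP #|W|; elim: m W => // m IH W ltWm.
have [->|/set0Pn[w wW]] := eqVneq W set0.
  exists set0; split.
  - apply/and3P; split; rewrite ?inE //; last by apply/forall_inP => X; rewrite inE.
    by rewrite /trivIset /cover !big_set0 cards0.
  - by rewrite /cover big_set0.
  move=> I; rewrite subset0 => /eqP-> _; rewrite /cover big_set0.
  by apply/two_dicolorableP; exists (fun=> true) => -[|x z] b // _ zI; have := zI x (mem_head _ _); rewrite inE.
pose good X := [&& X \subset W, strongly_connected arc X & two_dicolorable X].
(* Maximality among subsets of [W] suffices, as all later parts lie inside [W]. *)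
have [X maxX wX] : {X | maxset good X & [set w] \subset X}.
  apply: maxset_exists; rewrite /good sub1set wW strongly_connected1.
  exact: two_dicolorable1.
have /and3P[XW cX tX] := maxsetp maxX.
have wXX : w \in X by rewrite -sub1set.
have [|P [famP covP indP]] := IH (W :\: X).
  move: ltWm; rewrite -(cardsID X W) (setIidPr XW) => ltWm.
  have : 0 < #|X| by apply/card_gt0P; exists w.
  lia.
have [trP P0 cP] := and3P famP.
have disX Y : Y \in P -> [disjoint X & Y].
  move=> YP; rewrite disjoint_sym; apply: (disjointWl (bigcup_sup Y YP)).
  by rewrite -/(cover P) covP disjoints_subset setDE subsetIr.
have XnP : X \notin P.
  by apply/negP => /disX; rewrite -setI_eq0 setIid => /eqP e; rewrite e inE in wXX.
have covX (I : {set {set D}}) : X \in I -> cover I = X :|: cover (I :\ X).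
  by move=> XI; rewrite /cover (big_setD1 X).
exists (X |: P); split.
- apply/and3P; split.
  + apply/trivIsetP => A B; rewrite !inE => /predU1P[->|AP] /predU1P[->|BP].
    * by rewrite eqxx.
    * by move=> _; apply: disX.
    * by move=> _; rewrite disjoint_sym disX.
    * exact: (trivIsetP trP).
  + rewrite !inE negb_or P0 andbT; apply/eqP=> e; by rewrite -e inE in wXX.
  + by apply/forall_inP => A; rewrite !inE => /predU1P[->//|]; apply: (forall_inP cP).
- rewrite covX ?setU11 // setU1K // covP.
  by rewrite -{1}(setIidPr XW) setID.
move=> I sI indI.
have [XI|XnI] := boolP (X \in I); last first.
  apply: indP => //; apply/subsetP => A AI.
  have := subsetP sI A AI; rewrite !inE => /predU1P[eA|//].
  by rewrite -eA AI in XnI.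
rewrite covX //.
have sIX : I :\ X \subset P by rewrite subDset.
(* The rest of [I] plays the role of [Q]: a vertex of it with arcs from and to [X] would make its
   part biadjacent to [X]. *)
apply: two_dicolorableU => //.
- by apply/bigcup_disjointP => A /(subsetP sIX)/disX.
- move=> p /bigcupP[A AIX pA] /exists_inP[x xX xp]; apply/negP=> /exists_inP[y yX py].
  have /setD1P[AX AI] := AIX.
  apply: (negP (indI X A XI AI)); apply/biadjacentP; split.
  + by rewrite eq_sym.
  + by exists x, p.
  + by exists y, p.
- move=> X' pXX' sX' cX'; apply/negP => tX'.
  have gX' : good X'.
    rewrite /good cX' tX' !andbT; apply: subset_trans sX' _.
    rewrite subUset XW; apply/bigcupsP => A /(subsetP sIX) AP.
    apply: subset_trans (bigcup_sup A AP) _.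
    by rewrite -/(cover P) covP subsetDl.
  have [_ /(_ _ gX' (proper_sub pXX')) e] := maxsetP maxX.
  by move: pXX'; rewrite e properxx.
- apply: indP => // A B /setD1P[_ AI] /setD1P[_ BI]; exact: indI.
Qed.

(** Any finite type may supply the colors, so that pairs can be used. *)
Lemma dichromatic_number_leq (T : finType) (f : D -> T) :
  (forall i, acyclic [set x | f x == i]) -> dichromatic_number D <= #|T|.
Proof.
move=> acf; rewrite /dichromatic_number; case: ex_minnP => m _; apply.
apply/existsP; exists [ffun x => enum_rank (f x)]; apply/forallP => i.
have := acf (enum_val i); congr (is_true (acyclic _)).
by apply/setP => x; rewrite !inE ffunE -(can_eq enum_rankK) enum_valK.
Qed.

Lemma dense_branch_family (k : nat) : 2 * k < dichromatic_number D ->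
  exists R, [/\ branch_family R, R != set0 &
    {in R, forall X, k <= #|[set Y in R | biadjacent arc X Y]|}].
Proof.
have [P [famP covP indP]] := two_dicolorable_decomposition [set: D].
have [trP P0 cP] := and3P famP.
move=> ltk.
have [/existsP[R /and3P[RP R0 /forall_inP degR]]|] := boolP [exists R : {set {set D}},
    [&& R \subset P, R != set0 &
        [forall X in R, k <= #|[set Y in R | biadjacent arc X Y]|]]].
  exists R; split=> //; apply/and3P; split.
  - exact: trivIsetS trP.
  - by apply: contra P0; apply: (subsetP RP).
  - by apply/forall_inP => X /(subsetP RP); apply: (forall_inP cP).
rewrite negb_exists => /forallP noR; exfalso.
(* Without a dense subfamily, [P] splits into [k] classes of pairwise nonadjacent parts, each with a
   2-dicolorable union. *)
have [|||g [gk gP]] := @degenerate_coloring _ (biadjacent arc) k P.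
- exact: biadjacent_sym.
- exact: biadjacent_irrefl.
- move=> R RP R0; have := noR R; rewrite RP R0 /= negb_forall.
  by case/existsP => X; rewrite negb_imply -ltnNge => /andP[XR dX]; exists X.
have [k0|k_gt0] := posnP k.
  have : dichromatic_number D <= #|{: 'I_0}|; last by rewrite card_ord; lia.
  have noD (x : D) : False.
    have : x \in cover P by rewrite covP inE.
    by case/bigcupP => X /gk; rewrite k0.
  apply: (@dichromatic_number_leq _ (fun x => False_rect _ (noD x))) => i.
  by case: i.
pose cls i := [set X in P | g X == i].
have tw i : two_dicolorable (cover (cls i)).
  apply: indP => [|X Y]; first by apply/subsetP => X; rewrite inE => /andP[].
  rewrite !inE => /andP[XP /eqP gX] /andP[YP /eqP gY].
  by apply/negP => /(gP _ _ XP YP); rewrite gX gY eqxx.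
have /fin_all_exists[c hc] (i : 'I_k) : exists c : D -> bool, forall z b,
    dicycle z -> {subset z <= cover (cls i)} -> ~ {in z, forall x, c x = b}.
  by have /two_dicolorableP := tw i.
have lift x : g (pblock P x) < k.
  by apply: gk; apply: pblock_mem; rewrite covP inE.
(* The class of the part containing [x], paired with the color of [x] in that class: [2 * k]
   colors. *)
pose f x := (Ordinal (lift x), c (Ordinal (lift x)) x).
have : dichromatic_number D <= #|{: 'I_k * bool}|.
  apply: (@dichromatic_number_leq _ f) => -[i b]; apply/acyclicP => z cz zf.
  have zi x : x \in z -> Ordinal (lift x) = i /\ c i x = b.
    by move=> /zf; rewrite inE xpair_eqE => /andP[/eqP e /eqP]; rewrite e.
  apply: (hc i z b cz) => x /zi[ei ec] //.
  apply/bigcupP; exists (pblock P x); last by rewrite mem_pblock covP inE.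
  by rewrite inE pblock_mem ?covP ?inE //= -ei.
by rewrite card_prod card_ord card_bool; lia.
Qed.

End Families.

(** * Dense neighborhoods *)

Section Degrees.

Variables (T : finType) (e : rel T).
Hypotheses (sym_e : symmetric e) (irr_e : irreflexive e).
Implicit Types (P R S : {set T}).

Definition nbrs P x := [set y in P | e x y].

(** For symmetric [e], twice the number of edges inside [P]; average degree at least [d] then reads
    [d * #|P| <= degree_sum P]. *)
Definition degree_sum P := \sum_(x in P) #|nbrs P x|.

Lemma card_nbrs P x : #|nbrs P x| = \sum_(y in P) e x y.
Proof.
rewrite -sum1_card big_mkcond [RHS]big_mkcond; apply: eq_bigr => y _.
by rewrite inE; case: (y \in P); case: (e x y).
Qed.

Lemma degree_sumU1 P x : x \notin P ->
  degree_sum (x |: P) = degree_sum P + 2 * #|nbrs P x|.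
Proof.
move=> xP; have cU y : #|nbrs (x |: P) y| = e y x + #|nbrs P y|.
  by rewrite !card_nbrs big_setU1.
rewrite /degree_sum big_setU1 // cU irr_e add0n.
under eq_bigr => y _ do rewrite cU.
rewrite big_split /=.
under eq_bigr => y _ do rewrite sym_e.
by rewrite -card_nbrs; lia.
Qed.

Lemma min_degree_vertex P : P != set0 ->
  exists2 x, x \in P & #|P| * #|nbrs P x| <= degree_sum P.
Proof.
case/set0Pn => x0 x0P; pose x := [arg min_(x < x0 in P) #|nbrs P x|].
rewrite /degree_sum; case: (arg_minnP (fun x => #|nbrs P x|) x0P) => y yP ymin.
exists y => //; rewrite -sum_nat_const; apply: leq_sum => z; exact: ymin.
Qed.

End Degrees.

(** * Contraction of edges in branch families *)

Section Contraction.

Variable D : digraph.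
Local Notation adj := (biadjacent (@arc D)).
Implicit Types (X Y Z : {set D}) (P R : {set {set D}}).

Lemma branch_family_sub P R : R \subset P -> branch_family P -> branch_family R.
Proof.
move=> RP /and3P[trP P0 /forall_inP cP]; apply/and3P; split.
- exact: trivIsetS trP.
- by apply: contra P0; apply: (subsetP RP).
- by apply/forall_inP => X /(subsetP RP)/cP.
Qed.

(** Replacing [X] and [Y] by their union loses the edge between them and at most one edge per common
    neighbor; each lost edge counts twice. *)
Lemma contract_degree_sum P X Y : branch_family P -> X \in P -> Y \in P ->
  adj X Y ->
  exists P', [/\ branch_family P', P' != set0, #|P| = #|P'|.+1 &
    degree_sum adj P <=
      degree_sum adj P' + 2 * #|nbrs adj P X :&: nbrs adj P Y| + 2].
Proof.
move=> famP XP YP aXY; have [trP P0 /forall_inP cP] := and3P famP.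
have [neXY [x [y [xX yY rxy]]] [x' [y' [xX' yY' ryx]]]] := biadjacentP _ _ _ aXY.
pose R := P :\ X :\ Y; pose Z := X :|: Y.
have RP W : W \in R -> W \in P by rewrite !inE => /and3P[].
have eP : P = X |: (Y |: R).
  by rewrite /R setD1K ?setD1K // !inE eq_sym neXY.
have YR : Y \notin R by rewrite !inE eqxx.
have XYR : X \notin Y |: R by rewrite !inE negb_or neXY eqxx andbF.
have XR : X \notin R by rewrite !inE eqxx andbF.
have disR W : W \in R -> [disjoint Z & W].
  move=> WR; have WP := RP W WR; rewrite disjoint_sym disjoints_subset setCU subsetI -!disjoints_subset.
  by apply/andP; split; apply: (trivIsetP trP) => //; move: WR; rewrite !inE => /and3P[].
have ZR : Z \notin R.
  apply/negP => /disR; rewrite -setI_eq0 setIid => /eqP e.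
  have : x \in Z by rewrite inE xX.
  by rewrite e inE.
have adjZ W : W \in R -> adj X W || adj Y W -> adj Z W.
  move=> WR h; apply/biadjacentP; split.
  - by apply: contraNneq ZR => ->.
  - by case/orP: h => /biadjacentP[_ [u [v [u1 v1 uv]]] _]; exists u, v; split=> //; rewrite inE u1 ?orbT.
  - by case/orP: h => /biadjacentP[_ _ [u [v [u1 v1 uv]]]]; exists u, v; split=> //; rewrite inE u1 ?orbT.
exists (Z |: R); split.
- apply/and3P; split.
  + apply/trivIsetP => U V; rewrite !in_setU1 => /predU1P[->|UR] /predU1P[->|VR].
    * by rewrite eqxx.
    * by move=> _; apply: disR.
    * by move=> _; rewrite disjoint_sym disR.
    * by apply: (trivIsetP trP); apply: RP.
  + rewrite in_setU1 negb_or; apply/andP; split; last first.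
      by apply: contra P0; apply: RP.
    apply/eqP=> e; have : x \in Z by rewrite inE xX.
    by rewrite -e inE.
  + apply/forall_inP => U; rewrite in_setU1 => /predU1P[->|/RP/cP//].
    exact: (strongly_connectedU (cP _ XP) (cP _ YP) xX yY rxy xX' yY' ryx).
- by apply/set0Pn; exists Z; rewrite setU11.
- by rewrite {1}eP !cardsU1 XYR YR ZR.
rewrite {1}eP !degree_sumU1 //; try exact: biadjacent_sym; try exact: biadjacent_irrefl.
have -> : #|nbrs adj (Y |: R) X| = (#|nbrs adj R X|).+1.
  by rewrite !card_nbrs big_setU1 //= aXY.
(* Only an inequality: a set with an arc from [X] and an arc to [Y] may become a new neighbor of the
   union. *)
have : #|nbrs adj R X :|: nbrs adj R Y| <= #|nbrs adj R Z|.
  apply/subset_leq_card/subsetP => W; rewrite in_setU ![W \in nbrs _ _ _]inE.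
  by case/orP => /andP[WR a]; rewrite WR adjZ // a ?orbT.
have : #|nbrs adj R X :&: nbrs adj R Y| <= #|nbrs adj P X :&: nbrs adj P Y|.
  by apply: subset_leq_card; apply: setISS; apply/subsetP => W;
    rewrite ![W \in nbrs _ _ _]inE => /andP[/RP-> ->].
have := cardsUI (nbrs adj R X) (nbrs adj R Y).
by clear; lia.
Qed.

Lemma dense_neighborhood d R : 0 < d ->
  branch_family R -> R != set0 -> {in R, forall X, d <= #|nbrs adj R X|} ->
  exists S dl, [/\ branch_family S /\ S != set0, #|S| <= 2 * dl + 1, d <= 2 * dl + 1 &
    {in S, forall X, dl <= #|nbrs adj S X|}].
Proof.
move=> d0 famR R0 degR.
pose ok P := [&& branch_family P, P != set0 & d * #|P| <= degree_sum adj P].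
have okR : ok R.
  by rewrite /ok famR R0 mulnC -sum_nat_const; apply: leq_sum.
case: (arg_minnP (fun P : {set {set D}} => #|P|) okR) => P /and3P[famP nP dP] minP.
have [v vP dv] := min_degree_vertex adj nP.
(* The excess s raises both codegrees and the minimum degree, the former by s / 2
   and the latter by at most s. *)
pose s := degree_sum adj P - d * #|P|.
have eS : degree_sum adj P = d * #|P| + s by rewrite subnKC.
(* The contracted family is smaller, so by minimality it misses the density by at least 1; hence
   [d + s + 1 <= 2 * c + 2] for the codegree [c]. *)
have codeg Y : Y \in P -> adj v Y ->
    d + s <= 2 * #|nbrs adj P v :&: nbrs adj P Y| + 1.
  move=> YP avY; have [P' [famP' nP' cP']] := contract_degree_sum famP vP YP avY.
  rewrite eS cP' => leP'.
  have : degree_sum adj P' < d * #|P'|.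
    rewrite ltnNge; apply/negP => h; have := minP P'; rewrite /ok famP' nP' h cP'.
    by move=> /(_ isT); rewrite ltnn.
  by move: leP'; rewrite mulnS; clear; lia.
have P_gt0 : 0 < #|P| by rewrite card_gt0.
(* The degree of [v] is at most the average [d + s / #|P|]. *)
have dgv : #|nbrs adj P v| <= d + s.
  rewrite -(leq_pmul2l P_gt0); apply: leq_trans dv _.
  by rewrite eS mulnDr mulnC leq_add2l leq_pmull.
(* By [codeg] the codegrees are at least half of [d + s - 1], which rounds up to [(d + s)./2]. *)
exists (nbrs adj P v), (d + s)./2; split.
- split; first by apply: branch_family_sub famP; apply/subsetP => X; rewrite inE => /andP[].
  (* Deleting an isolated [v] would keep the degree sum and contradict minimality. *)
  apply/eqP => Nv0; have vR : v \notin P :\ v by rewrite !inE eqxx.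
  have eP : degree_sum adj (P :\ v) = degree_sum adj P.
    rewrite -{2}(setD1K vP) degree_sumU1 //; try exact: biadjacent_sym; try exact: biadjacent_irrefl.
    suff -> : nbrs adj (P :\ v) v = set0 by rewrite cards0 addn0.
    by apply/eqP; rewrite -subset0 -Nv0; apply/subsetP => X; rewrite !inE => /andP[/andP[_ ->]].
  have : ok (P :\ v).
    rewrite /ok (branch_family_sub (subsetDl _ _) famP) /= eP.
    rewrite (leq_trans _ dP) ?leq_mul2l ?subset_leq_card ?subsetDl ?orbT // andbT.
    apply: contraTneq dP => e0.
    by rewrite -eP e0 /degree_sum big_set0 -ltnNge muln_gt0 d0.
  by move/minP; rewrite (cardsD1 v P) vP ltnn.
- by apply: leq_trans dgv _; move: (d + s) => m; clear; lia.
- by apply: leq_trans (leq_addr s d) _; move: (d + s) => m; clear; lia.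
move=> X; rewrite inE => /andP[XP vX].
have -> : nbrs adj (nbrs adj P v) X = nbrs adj P v :&: nbrs adj P X.
  by apply/setP => Y; rewrite !inE; case: (Y \in P).
by have := codeg X XP vX; move: (d + s) #|_| => m c; clear; lia.
Qed.

End Contraction.

(** * Subcubic minors of dense graphs *)

Section SubcubicMinor.

Variables (T : finType) (e : rel T).
Hypotheses (sym_e : symmetric e) (irr_e : irreflexive e).
Implicit Types (A B S U J : {set T}).

(* The sets inducing a connected subgraph of e. *)
Inductive grown : {set T} -> Prop :=
| grown1 x : grown [set x]
| grownU A y z : grown A -> z \in A -> e z y -> grown (y |: A).

Lemma grown_neq0 A : grown A -> A != set0.
Proof.
by case=> [x|B y z _ _ _]; apply/set0Pn; [exists x; rewrite inE | exists y; rewrite setU11].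
Qed.

(** [U] holds the vertices in use; [j1 == j2] covers paths with a single internal vertex. *)
Definition linked S U : rel T := fun a b =>
  [exists j1 in S :\: U, exists j2 in S :\: U,
     [&& e a j1, (j1 == j2) || e j1 j2 & e j2 b]].

Lemma inj_into (I : finType) A : #|I| <= #|A| ->
  exists f : I -> T, injective f /\ forall i, f i \in A.
Proof.
move=> leIA; exists (fun i => enum_val (widen_ord leIA (enum_rank i))); split.
  by move=> i j /enum_val_inj/(congr1 val)/= /ord_inj/enum_rank_inj.
by move=> i; apply: enum_valP.
Qed.

Variable H : digraph.

(** A minor model for an arbitrary relation [R], so that it also applies to the routed arcs
    alone. *)
Definition model_of S (R : H -> H -> Prop) (C : H -> {set T}) :=
  [/\ forall u, grown (C u), forall u, C u \subset S,
      forall u v, u != v -> [disjoint C u & C v] &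
      forall u v, R u v -> exists x y, [/\ x \in C u, y \in C v & e x y]].

(* The internal vertices of each new path join the branch set of its tail. *)
Lemma route S q L (f : H -> T) (es : seq (H * H)) :
  injective f -> (forall u, f u \in S) ->
  #|H| + q * (size es).-1 <= L ->
  (forall u v U, (u, v) \in es -> #|U| <= L ->
     exists j1 j2, [/\ j1 \in S :\: U, j2 \in S :\: U, e (f u) j1,
       (j1 == j2) || e j1 j2 & e j2 (f v)] /\ #|[set j1; j2]| <= q) ->
  exists C, [/\ model_of S (fun u v => (u, v) \in es) C,
     forall u, f u \in C u &
     #|\bigcup_u C u| <= #|H| + q * size es].
Proof.
move=> inj_f fS; elim: es => [|[u v] es IH] leL linkL.
  exists (fun u => [set f u]); split; last 2 first.
  - by move=> u; rewrite inE.
  - rewrite muln0 addn0; apply: (@leq_trans #|codom f|); last by rewrite card_codom.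
    by apply/subset_leq_card/subsetP => x /bigcupP[u _ /set1P->]; apply: codom_f.
  split=> //.
  - by move=> u; apply: grown1.
  - by move=> u; rewrite sub1set.
  - by move=> u v nuv; rewrite disjoints1 inE inj_eq // .
have [||C [[gC CS dC eC] fC cC]] := IH.
- apply: leq_trans leL; rewrite /= leq_add2l leq_mul2l leq_pred orbT //.
- by move=> u' v' U uv' leU; apply: linkL => //; rewrite inE uv' orbT.
(* Only the arcs of the tail are routed so far, hence the predecessor in the bound on [L]. *)
have [j1 [j2 [[j1S j2S ej1 ej12 ej2] cJ]]] :=
  linkL u v (\bigcup_u C u) (mem_head _ _) (leq_trans cC leL).
pose J := [set j1; j2].
have JC w : [disjoint J & C w].
  apply/pred0P => x /=; apply/negP => /andP[xJ xC].
  have xU : x \in \bigcup_u C u by apply/bigcupP; exists w.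
  by move: xJ; rewrite !inE => /orP[]/eqP ex; [move: j1S|move: j2S]; rewrite -ex inE xU.
exists (fun w => if w == u then J :|: C w else C w); split.
- split.
  + move=> w; case: eqVneq => [->|_] //; rewrite /J.
    have -> : [set j1; j2] :|: C u = j2 |: (j1 |: C u).
      by rewrite setUA [[set j2; j1]]setUC.
    have g1 : grown (j1 |: C u) by apply: grownU ej1.
    case/orP: ej12 => [/eqP<-|ej12]; first by rewrite setUA setUid.
    by apply: grownU g1 _ ej12; rewrite setU11.
  + move=> w; case: eqVneq => // _; rewrite subUset CS andbT.
    by rewrite subUset !sub1set; case/setDP: j1S => ->; case/setDP: j2S => ->.
  + have dJ w w' : w != w' -> [disjoint J :|: C w & C w'].
      by move=> ne; rewrite -setI_eq0 setIUl setU_eq0 !setI_eq0 JC dC.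
    move=> w w' ne; case: (eqVneq w u) => [ew|_]; case: (eqVneq w' u) => [ew'|_].
    * by rewrite ew ew' eqxx in ne.
    * exact: dJ.
    * by rewrite disjoint_sym dJ // eq_sym.
    * exact: dC.
  + have subC w : C w \subset (if w == u then J :|: C w else C w).
      by case: ifP => // _; apply: subsetUr.
    move=> u' v'; rewrite inE => /predU1P[[-> ->]|/eC[x [y [xC yC exy]]]].
      exists j2, (f v); rewrite eqxx !inE eqxx orbT; split=> //.
      exact: (subsetP (subC v)).
    by exists x, y; split=> //; [apply: (subsetP (subC u')) | apply: (subsetP (subC v'))].
- by move=> w; case: ifP => // _; rewrite inE fC orbT.
- rewrite /= mulnS addnCA; apply: leq_trans (leq_add cJ cC).
  apply: leq_trans (leq_card_setU _ _); apply/subset_leq_card/bigcupsP => w _.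
  have CU : C w \subset \bigcup_u C u by apply: bigcup_sup.
  case: ifP => _; last by apply: subset_trans CU (subsetUr _ _).
  exact: setUS.
Qed.

Hypothesis arc_asym : forall u v : H, arc u v -> ~~ arc v u.

Let h (u v : H) := arc u v || arc v u.

Hypothesis deg_h : forall u, #|[set v | h u v]| <= 3.

(** Double counting: each arc counts at both its ends, and no two arcs are opposite. *)
Lemma card_arcs_leq (p : rel H) d : symmetric p ->
  (forall u, #|[set v | h u v && p u v]| <= d) ->
  2 * #|[set uv : H * H | arc uv.1 uv.2 && p uv.1 uv.2]| <= d * #|H|.
Proof.
move=> sym_p degp.
have -> : #|[set uv : H * H | arc uv.1 uv.2 && p uv.1 uv.2]| =
    \sum_u \sum_v (arc u v && p u v : nat).
  rewrite pair_bigA /= -sum1_card big_mkcond /=; apply: eq_bigr => -[u v] _.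
  by rewrite inE /=; case: (_ && _).
rewrite mulnC muln2 -addnn {2}exchange_big -big_split /= mulnC -sum_nat_const.
apply: leq_sum => u _; apply: leq_trans (degp u).
rewrite -big_split -sum1_card /= [leqRHS]big_mkcond; apply: leq_sum => v _.
rewrite inE /h (sym_p v u); case: (p u v); rewrite ?andbF ?andbT //.
by have := @arc_asym u v; case: (arc u v) => [/(_ isT)/negbTE->|]; case: (arc v u).
Qed.

Lemma good_placement S n : n < #|S| -> #|H| <= n ->
  {in S, forall x, n < #|nbrs e S x|} ->
  exists f : H -> T, [/\ injective f, forall u, f u \in S &
    #|[set uv : H * H | arc uv.1 uv.2 && ~~ e (f uv.1) (f uv.2)]| <= #|H|].
Proof.
move=> nS Hn degS.
have [|f0 [inj_f0 f0S]] := @inj_into H S; first by apply: leq_trans Hn (ltnW nS).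
pose good (f : {ffun H -> T}) := injectiveb f && [forall u, f u \in S].
have good0 : good (finfun f0).
  apply/andP; split; first by apply/injectiveP => u v; rewrite !ffunE => /inj_f0.
  by apply/forallP => u; rewrite ffunE.
pose direct (f : {ffun H -> T}) := [set uv : H * H | h uv.1 uv.2 && e (f uv.1) (f uv.2)].
case: (arg_maxnP (fun f => #|direct f|) good0) => f /andP[/injectiveP inj_f /forallP fS] maxf.
exists f; split=> //.
have sym_p : symmetric (fun u v => ~~ e (f u) (f v)) by move=> u v; rewrite sym_e.
suff deg2 u : #|[set v | h u v && ~~ e (f u) (f v)]| <= 2.
  by have := card_arcs_leq sym_p deg2; rewrite leq_mul2l.
rewrite leqNgt; apply/negP => gt2.
(* Three unrealized arcs at [u] are all its arcs, so moving [u] loses nothing. *)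
have eqN : [set v | h u v && ~~ e (f u) (f v)] = [set v | h u v].
  apply/eqP; rewrite eqEcard (leq_trans (deg_h u) gt2) andbT.
  by apply/subsetP => v; rewrite !inE => /andP[].
have indir v : h u v -> ~~ e (f u) (f v).
  move=> huv; have : v \in [set v | h u v] by rewrite inE.
  by rewrite -eqN inE => /andP[].
have [v] : exists v, v \in [set v | h u v && ~~ e (f u) (f v)].
  by apply/card_gt0P; apply: leq_trans gt2.
rewrite eqN inE => huv.
(* [f v] has more than [n] neighbors, so one is free; moving [u] there gains the arc between [u] and
   [v]. *)
have /subsetPn[z zN zf] : ~~ (nbrs e S (f v) \subset codom f).
  apply: contraTN (degS _ (fS v)) => /subset_leq_card; rewrite -leqNgt => le1.
  by apply: leq_trans le1 _; rewrite card_codom.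
have [zS ez] : z \in S /\ e (f v) z by move: zN; rewrite inE => /andP[].
pose f' := [ffun w => if w == u then z else f w].
have uv : v != u.
  by apply: contraTneq huv => ->; rewrite /h arc_irrefl.
have good' : good f'.
  apply/andP; split.
    apply/injectiveP => w w'; rewrite !ffunE.
    case: (eqVneq w u) => [->|_]; case: (eqVneq w' u) => [->|_] // ew.
    - by move: zf; rewrite ew codom_f.
    - by move: zf; rewrite -ew codom_f.
    - exact: inj_f.
  by apply/forallP => w; rewrite ffunE; case: ifP.
have := maxf f' good'; apply/negP; rewrite -ltnNge; apply/proper_card/properP; split.
  apply/subsetP => -[w w']; rewrite !inE /= => /andP[hw ew]; rewrite hw /= !ffunE.
  case: (eqVneq w u) => [eu|_]; first by move: ew; rewrite eu (negbTE (indir _ _)) // -eu.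
  case: (eqVneq w' u) => [eu|_] //.
  by move: ew; rewrite eu sym_e (negbTE (indir _ _)) // -eu /h orbC.
exists (u, v); rewrite inE /= huv ?(negbTE (indir _ _)) //= !ffunE eqxx (negbTE uv).
by rewrite sym_e.
Qed.

Lemma cards2_leq2 (x y : T) : #|[set x; y]| <= 2.
Proof. by rewrite cards2; case: (x != y). Qed.

Lemma dense_subcubic_minor S n dl : 0 < n -> #|H| <= n ->
  #|S| <= 2 * dl + 1 -> 11 * n <= 2 * dl + 2 ->
  {in S, forall x, dl <= #|nbrs e S x|} -> S != set0 ->
  exists C, model_of S arc C.
Proof.
move=> n0 Hn cS ndl degS nS.
have ltS x : x \in S -> dl < #|S|.
  move=> xS; apply: leq_ltn_trans (degS x xS) _; apply: proper_card; apply/properP; split.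
    by apply/subsetP => y; rewrite inE => /andP[].
  by exists x => //; rewrite inE irr_e andbF.
(* [3 * n - 2] is [n + 2 * (n - 1)], the number of vertices in use before the last of [n] routes
   with two internal vertices each. *)
have [/forallP allL|] := boolP [forall U : {set T}, (#|U| <= 3 * n - 2) ==>
    [forall a in S, forall b in S, linked S U a b]].
  have ndl' : n < dl by move: n0 ndl; clear; lia.
  have [||f [inj_f fS cI]] := @good_placement S n _ Hn.
  - by case/set0Pn: nS => x /ltS; apply: ltn_trans.
  - by move=> x /degS; apply: leq_trans.
  pose es := enum [set uv : H * H | arc uv.1 uv.2 && ~~ e (f uv.1) (f uv.2)].
  have szes : size es <= n by rewrite -cardE; apply: leq_trans Hn.
  have [||C [[gC CS dC eC] fC _]] := @route S 2 (3 * n - 2) f es inj_f fS.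
  - by move: Hn szes n0; move: #|H| (size es) => m k; clear; lia.
  - move=> u v U _ leU; have /implyP/(_ leU)/forall_inP/(_ _ (fS u))/forall_inP/(_ _ (fS v)) := allL U.
    case/exists_inP => j1 j1S /exists_inP[j2 j2S /and3P[a1 a2 a3]].
    by exists j1, j2; split=> //; apply: cards2_leq2.
  exists C; split=> // u v uv; case ef: (e (f u) (f v)); first by exists (f u), (f v).
  by apply: eC; rewrite mem_enum inE uv /= ef.
rewrite negb_forall => /existsP[U]; rewrite negb_imply => /andP[leU].
rewrite negb_forall => /existsP[a]; rewrite negb_imply => /andP[aS].
rewrite negb_forall => /existsP[b]; rewrite negb_imply => /andP[bS nab].
(* An edge between [A0] and [B0] would link [a] to [b]; both sets have at least [dl - (3 * n - 2)]
   elements. *)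
pose A0 := nbrs e S a :\: U; pose B0 := nbrs e S b :\: U.
have AS : A0 \subset S by apply/subsetP => x; rewrite !inE => /and3P[].
have BS : B0 \subset S by apply/subsetP => x; rewrite !inE => /and3P[].
have card0 x : x \in S -> dl <= #|nbrs e S x :\: U| + (3 * n - 2).
  move=> /degS h1; apply: leq_trans h1 _; rewrite -(cardsID U (nbrs e S x)) addnC.
  by rewrite leq_add2l (leq_trans _ leU) // subset_leq_card // subsetIr.
have nAB x y : x \in A0 -> y \in B0 -> ~~ e x y.
  rewrite 2!inE => /and3P[xU xS ax]; rewrite 2!inE => /and3P[yU yS bY].
  apply: contra nab => exy; apply/exists_inP; exists x; first by rewrite inE xU.
  apply/exists_inP; exists y; first by rewrite inE yU.
  by rewrite ax exy orbT /= sym_e.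
(* Both neighborhoods avoid [B0], so their union has at most [dl + 3 * n - 1] elements and their
   intersection at least [dl - 3 * n + 1]. *)
have common x y : x \in A0 -> y \in A0 ->
    5 * n <= 2 * #|nbrs e S x :&: nbrs e S y|.
  move=> xA yA; have xS := subsetP AS x xA; have yS := subsetP AS y yA.
  have sub z : z \in A0 -> nbrs e S z \subset S :\: B0.
    move=> zA; apply/subsetP => w; rewrite in_setD inE => /andP[wS zw]; rewrite wS andbT.
    by apply/negP => /(nAB z w zA); rewrite zw.
  have : #|nbrs e S x :|: nbrs e S y| <= #|S :\: B0|.
    by apply: subset_leq_card; rewrite subUset !sub.
  have := cardsUI (nbrs e S x) (nbrs e S y).
  have := cardsID B0 S; rewrite (setIidPr BS).
  move: (degS x xS) (degS y yS) (card0 b bS) cS ndl n0; rewrite -/B0.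
  move: #|nbrs e S x| #|nbrs e S y| #|nbrs e S x :|: _| #|_ :&: _| #|B0| #|S| #|S :\: B0|.
  by clear; lia.
have [|f [inj_f fA]] := @inj_into H A0.
  apply: leq_trans Hn _; move: (card0 a aS) ndl n0; rewrite -/A0; move: #|A0|.
  by clear; lia.
(* All arcs, with [true] added to match [card_arcs_leq]; there are at most 3n/2. *)
pose es := enum [set uv : H * H | arc uv.1 uv.2 && true].
have szes : 2 * size es <= 3 * n.
  rewrite -cardE; apply: leq_trans (@card_arcs_leq (fun _ _ => true) 3 _ _) _ => // [u|].
    by rewrite (leq_trans _ (deg_h u)) // subset_leq_card //; apply/subsetP => v; rewrite !inE andbT.
  by rewrite leq_mul2l.
have fS u : f u \in S by apply: (subsetP AS).
have [|C [[gC CS dC eC] fC _]] :=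
    @route S 1 (#|H| + 1 * (size es).-1) f es inj_f fS (leqnn _).
(* At most n + 3n/2 - 1 vertices are in use, fewer than the 5n/2 common neighbors. *)
- move=> u v U' uv leU'; have := common _ _ (fA u) (fA v) => cm.
  have : ~~ (nbrs e S (f u) :&: nbrs e S (f v) \subset U').
    apply/negP => /subset_leq_card.
    have : 0 < size es by case: (es) uv.
    move: leU' cm szes Hn; move: #|_ :&: _| #|U'| (size es) #|H|; clear; lia.
  case/subsetPn => j; rewrite !inE => /andP[/andP[jS uj] /andP[_ vj]] jU.
  exists j, j; rewrite !inE jU jS uj eqxx sym_e vj setUid cards1; by split.
exists C; split=> // u v uv; apply: eC; by rewrite mem_enum inE uv.
Qed.

End SubcubicMinor.

(** * From branch sets to subdivisions *)

Section Star.

Variable T : finType.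
Implicit Types (r : rel T) (B : {set T}).

Lemma simple_path_in r B x y : connect (rel_in r B) x y -> x \in B ->
  exists s, [/\ path r x s, last x s = y, uniq (x :: s) & {subset x :: s <= B}].
Proof.
case/connectP => s ps -> xB; case/shortenP: ps => s' ps' us' _.
have [prs sB] := path_rel_in _ _ xB ps'; exists s'; split=> // z.
by rewrite inE => /predU1P[->|/sB].
Qed.

(** On a simple path from [b] to [a1], the center [c] is the last vertex met by a walk from [b] to
    [a2]. *)
Lemma tripod r B b a1 a2 :
  strongly_connected r B -> b \in B -> a1 \in B -> a2 \in B ->
  exists c s0 s1 s2,
    [/\ path (converse r) c s0 /\ last c s0 = b,
        path r c s1 /\ last c s1 = a1,
        path r c s2 /\ last c s2 = a2,
        uniq (c :: s0 ++ s1 ++ s2) & {subset c :: s0 ++ s1 ++ s2 <= B}].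
Proof.
move=> /strongly_connectedP cB bB a1B a2B.
have [R [pR lR uR RB]] := simple_path_in (cB b a1 bB a1B) bB.
have [c [s2 [cR ps2 ls2 us2 [dR s2B]]]] : exists c s2,
    [/\ c \in b :: R, path r c s2, last c s2 = a2, uniq s2 &
        ~~ has [in b :: R] s2 /\ {subset s2 <= B}].
  have [a2R|a2R] := boolP (a2 \in b :: R); first by exists a2, [::]; split.
  pose X := [set x in b :: R].
  have XB : X \subset B by apply/subsetP => x; rewrite inE => /RB.
  have d : [disjoint X & B :\: X] by rewrite disjoint_sym disjoints_subset setDE subsetIr.
  have eB : B = X :|: (B :\: X) by rewrite -{1}(setID B X) (setIidPr XB).
  have ba2 : connect (rel_in r (X :|: (B :\: X))) b a2 by rewrite -eB cB.
  have bX : b \in X by rewrite inE mem_head.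
  have a2D : a2 \in B :\: X by rewrite inE [a2 \in X]inE a2R.
  have [c [p [cX pQ rcp pa2]]] := last_exit d ba2 bX a2D.
  have [s [ps ls us sQ]] := simple_path_in pa2 pQ.
  exists c, (p :: s); split=> //.
  - by move: cX; rewrite inE.
  - by rewrite /= rcp.
  split.
    by apply/hasPn => z /sQ; rewrite !inE => /andP[].
  by move=> z /sQ /setDP[].
case/splitPl: cR pR lR uR RB dR => p1 p2 lc; rewrite cat_path last_cat lc => /andP[pp1 pp2] l2 u12 RB dR.
have eq_rev : c :: rev (belast b p1) = rev (b :: p1) by rewrite -lc -rev_rcons -lastI.
exists c, (rev (belast b p1)), p2, s2; split=> //.
- split; first by rewrite -lc rev_path.
  by case: (p1) lc => [<-//|y p _] /=; rewrite rev_cons last_rcons.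
- rewrite -cat_cons eq_rev catA cat_uniq; apply/and3P; split=> //.
    by rewrite cat_uniq rev_uniq (eq_has (a2 := [in b :: p1])) -?cat_uniq // => z; rewrite /= mem_rev.
  apply: contra dR => /hasP[z zs zR]; apply/hasP; exists z => //.
  by move: zR; rewrite /= -cat_cons !mem_cat mem_rev.
- move=> z; rewrite -cat_cons eq_rev catA !mem_cat mem_rev -mem_cat.
  by case/orP => [zR|/s2B//]; apply: RB.
Qed.

Variable J : finType.

(* The center and, for each j, the vertices after the center on the path
   leaving it for t_out j, and on the path reaching it from t_in j read
   backwards. *)
Definition star r B (I O : {set J}) (t_in t_out : J -> T)
    (x : T * (J -> seq T) * (J -> seq T)) :=
  let: (c, s_in, s_out) := x in
  [/\ c \in B,
      forall j, j \in O -> [/\ path r c (s_out j), last c (s_out j) = t_out j,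
        uniq (c :: s_out j) & {subset s_out j <= B}],
      forall j, j \in I -> [/\ path (converse r) c (s_in j),
        last c (s_in j) = t_in j, uniq (c :: s_in j) & {subset s_in j <= B}] &
      [/\ {in O &, forall i j, i != j -> ~~ has [in s_out i] (s_out j)},
          {in I &, forall i j, i != j -> ~~ has [in s_in i] (s_in j)} &
          {in I & O, forall i j, ~~ has [in s_in i] (s_out j)}]].

Lemma subset_set2 (j0 : J) (A : {set J}) : #|A| <= 2 ->
  exists i j, A \subset [set i; j].
Proof.
rewrite cardE => A2; exists (nth j0 (enum A) 0), (nth j0 (enum A) 1).
apply/subsetP => x; rewrite -mem_enum !inE.
by case: (enum A) A2 => [|y [|z [|]]] //= _; rewrite !inE // => ->.
Qed.

Lemma star_exists1 (j0 : J) r B (I O : {set J}) (t_in t_out : J -> T) :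
  strongly_connected r B -> (forall j, t_in j \in B) -> (forall j, t_out j \in B) ->
  #|I| <= 1 -> #|O| <= 2 -> exists x, star r B I O t_in t_out x.
Proof.
(* Missing terminals are padded; [star] constrains only the legs for [I] and [O]. *)
move=> cB inB outB I1 /(subset_set2 j0)[o1 [o2 /subsetP O12]].
have [i Ii] : exists i, I \subset [set i].
  have [->|[i iI]] := set_0Vmem I; first by exists j0; rewrite sub0set.
  exists i; apply/subsetP => j jI; rewrite inE; apply/eqP.
  exact: (card_le1_eqP I1).
have [c [s0 [s1 [s2 [[p0 l0] [p1 l1] [p2 l2]]]]]] :=
  tripod cB (inB i) (outB o1) (outB o2).
rewrite /= !mem_cat !negb_or !cat_uniq has_cat negb_or.
move=> /and5P[/and3P[c0 c1 c2] u0 /andP[d01 d02] u1 /andP[d12 u2]] sB.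
have cBm : c \in B by apply: sB; rewrite mem_head.
have s0B : {subset s0 <= B} by move=> z zs; apply: sB; rewrite inE !mem_cat zs !orbT.
have s1B : {subset s1 <= B} by move=> z zs; apply: sB; rewrite inE !mem_cat zs !orbT.
have s2B : {subset s2 <= B} by move=> z zs; apply: sB; rewrite inE !mem_cat zs !orbT.
exists (c, (fun=> s0), (fun j => if j == o1 then s1 else s2)); split=> //.
- move=> j /O12; case: (eqVneq j o1) => [-> _|ne]; first by split=> //=; rewrite c1.
  by rewrite !inE (negbTE ne) /= => /eqP->; split=> //=; rewrite c2.
- by move=> j /(subsetP Ii)/set1P->; split=> //=; rewrite c0.
split.
- move=> j j' /O12; rewrite !inE => jO /O12; rewrite !inE => j'O ne.
  have [ej|nj] := eqVneq j o1; have [ej'|nj'] := eqVneq j' o1.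
  + by rewrite ej ej' eqxx in ne.
  + by [].
  + by rewrite has_sym.
  + by move: jO j'O ne; rewrite (negbTE nj) (negbTE nj') => /eqP-> /eqP->; rewrite eqxx.
- by move=> j j' /(subsetP Ii)/set1P-> /(subsetP Ii)/set1P->; rewrite eqxx.
- by move=> j j' _ _; case: ifP.
Qed.

Lemma star_converse r B (I O : {set J}) t_in t_out c s_in s_out :
  star (converse r) B O I t_out t_in (c, s_out, s_in) ->
  star r B I O t_in t_out (c, s_in, s_out).
Proof.
case=> cB h1 h2 [h3 h4 h5]; split=> //; split=> // i j iI jO.
by rewrite has_sym h5.
Qed.

(** One of [I] and [O] has at most one element, and reversing all arcs exchanges them. *)
Lemma star_exists (j0 : J) r B (I O : {set J}) (t_in t_out : J -> T) :
  strongly_connected r B -> (forall j, t_in j \in B) -> (forall j, t_out j \in B) ->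
  #|I| <= 2 -> #|O| <= 2 -> #|I| + #|O| <= 3 ->
  exists x, star r B I O t_in t_out x.
Proof.
move=> cB inB outB I2 O2 IO3.
have [I1|I1] := leqP #|I| 1; first exact: star_exists1.
have O1 : #|O| <= 1 by lia.
have [|[[c s_out] s_in] st] := @star_exists1 j0 (converse r) B O I t_out t_in _ outB inB O1 I2.
  by rewrite strongly_connected_converse.
by exists (c, s_in, s_out); apply: star_converse.
Qed.

End Star.

(** * Assembling the subdivision from stars *)

Section Embedding.

Variables D H : digraph.

Lemma mem_zip_path (T : eqType) (r : rel T) a s b x y :
  path r a (rcons s b) -> (x, y) \in zip (a :: s) (rcons s b) -> r x y.
Proof.
elim: s a => [|z s IH] a /=; first by rewrite andbT inE => rab /eqP[-> ->].
by case/andP => raz ps; rewrite inE => /predU1P[[-> ->]//|]; apply: IH.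
Qed.

Lemma mem_zip_map (T U : eqType) (g : T -> U) s t x y : injective g ->
  ((g x, g y) \in zip (map g s) (map g t)) = ((x, y) \in zip s t).
Proof.
move=> inj_g; elim: s t => [|a s IH] [|b t] //=.
by rewrite !inE IH !xpair_eqE !inj_eq.
Qed.

(** The used vertices form a subtype carrying only the arcs of the paths, since [D] may have further
    arcs between them. *)
Lemma contains_subdivision_paths (f : H -> D) (P : H -> H -> seq D) :
  injective f ->
  (forall u v, arc u v -> [/\ path arc (f u) (rcons (P u v) (f v)),
     uniq (f u :: rcons (P u v) (f v)) & forall x, x \in P u v -> x \notin codom f]) ->
  (forall u v u' v', arc u v -> arc u' v' -> (u, v) <> (u', v') ->
     forall x, x \in P u v -> x \notin P u' v') ->
  contains_subdivision D H.
Proof.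
move=> inj_f pathP disP.
pose used := [set x | (x \in codom f) ||
  [exists u, exists v, arc u v && (x \in P u v)]].
pose V := {x : D | x \in used}.
pose arcV : rel V := fun x y => [exists u, exists v, arc u v &&
  ((val x, val y) \in zip (f u :: P u v) (rcons (P u v) (f v)))].
have arcVD x y : arcV x y -> arc (val x) (val y).
  case/existsP => u /existsP[v /andP[uv]].
  by apply: mem_zip_path; case: (pathP u v uv).
have irrV : irreflexive arcV.
  by move=> x; case xx: (arcV x x) => //; have := arcVD x x xx; rewrite arc_irrefl.
have fU u : f u \in used by rewrite inE codom_f.
pose f' u : V := exist _ (f u) (fU u).
pose P' u v : seq V := pmap insub (P u v).
have mapP' u v : arc u v -> map val (P' u v) = P u v.
  move=> uv; rewrite /P' (pmap_filter (insubK _)); apply/all_filterP/allP => x xP.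
  rewrite isSome_insub inE; apply/orP; right.
  by apply/existsP; exists u; apply/existsP; exists v; rewrite uv.
have memP' u v x : arc u v -> (x \in P' u v) = (val x \in P u v).
  by move=> uv; rewrite -mapP' // mem_map //; apply: val_inj.
have memf' x : (x \in codom f') = (val x \in codom f).
  apply/codomP/codomP => -[u e]; exists u; first by rewrite e.
  exact: val_inj.
exists (Digraph irrV); split; last by exists val; split; [exact: val_inj | exact: arcVD].
exists f', P'; split.
- by move=> u v /(congr1 val)/inj_f.
- move=> u v uv; have [_ u1 u2] := pathP u v uv; split.
    rewrite -(map_inj_uniq val_inj) /= map_rcons mapP' //.
  by move=> x; rewrite memP' // memf'; apply: u2.
- by move=> u v u' v' uv uv' ne x; rewrite !memP' //; apply: disP.
- move=> x; have := valP x; rewrite inE => /orP[xf|/existsP[u /existsP[v /andP[uv xP]]]].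
    by left; rewrite memf'.
  by right; exists u, v; rewrite memP'.
- have zipE u v (x y : V) : arc u v ->
      ((x, y) \in zip (f' u :: P' u v) (rcons (P' u v) (f' v))) =
      ((val x, val y) \in zip (f u :: P u v) (rcons (P u v) (f v))).
    by move=> uv; rewrite -(mem_zip_map _ _ _ _ val_inj) /= map_rcons mapP'.
  move=> x y; split.
    by case/existsP => u /existsP[v /andP[uv xy]]; exists u, v; rewrite zipE.
  case=> u [v [uv xy]]; apply/existsP; exists u; apply/existsP; exists v.
  by rewrite uv /= -zipE.
Qed.

Lemma subcubic_degrees : subcubic H ->
  [/\ forall u v : H, arc u v -> ~~ arc v u,
      forall u : H, #|[set v | arc u v || arc v u]| <= 3,
      forall u : H, #|[set v | arc v u]| <= 2 &
      forall u : H, #|[set v | arc u v]| <= 2].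
Proof.
case=> -[e [sym_e irr_e dege [arce ore]]] deg2; split.
- by move=> u v uv; have := ore u v (arce u v uv); rewrite uv.
- move=> u; apply: leq_trans (dege u); apply/subset_leq_card/subsetP => v.
  by rewrite !inE => /orP[/arce|/arce]; rewrite // sym_e.
- by move=> u; case: (deg2 u).
- by move=> u; case: (deg2 u).
Qed.

(** The centers of stars represent the vertices of [H]; the path for [(u, v)] follows a leg out of
    [u], the arc between the branch sets, and a leg into [v]. *)
Lemma contains_subdivision_minor (B : H -> {set D}) : subcubic H ->
  (forall u, strongly_connected arc (B u)) -> (forall u, B u != set0) ->
  (forall u v, u != v -> [disjoint B u & B v]) ->
  (forall u v, arc u v -> exists x y, [/\ x \in B u, y \in B v & arc x y]) ->
  contains_subdivision D H.
Proof.
move=> /subcubic_degrees[asymH deg3 in2 out2] cB B0 dB aB.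
have disB u v x : x \in B u -> x \in B v -> u = v.
  move=> xu xv; apply/eqP; apply: contraTT isT => /dB d.
  by rewrite (disjointFr d xu) in xv.
(* At non-arcs the pair is arbitrary, which keeps all terminals inside the branch sets. *)
have /fin_all_exists[t ht] (uv : H * H) : exists p : D * D,
    [/\ p.1 \in B uv.1, p.2 \in B uv.2 & arc uv.1 uv.2 -> arc p.1 p.2].
  case: uv => u v /=; case a: (arc u v).
    by have [x [y [xu yv xy]]] := aB u v a; exists (x, y).
  have [x xu] := set0Pn _ (B0 u); have [y yv] := set0Pn _ (B0 v).
  by exists (x, y).
have /fin_all_exists[s hs] (u : H) : exists s, star arc (B u)
    [set v | arc v u] [set v | arc u v]
    (fun v => (t (v, u)).2) (fun v => (t (u, v)).1) s.
  apply: (star_exists u) => //.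
  - by move=> v; case: (ht (v, u)).
  - by move=> v; case: (ht (u, v)).
  - apply: leq_trans (deg3 u); rewrite -cardsUI.
    have -> : [set v | arc v u] :&: [set v | arc u v] = set0.
      by apply/setP => v; rewrite !inE; apply/negP => /andP[/asymH/negbTE->].
    rewrite cards0 addn0; apply/subset_leq_card/subsetP => v; rewrite !inE.
    by rewrite orbC.
pose f u := (s u).1.1; pose s_in u := (s u).1.2; pose s_out u := (s u).2.
have {hs} hs u : star arc (B u) [set v | arc v u] [set v | arc u v]
    (fun v => (t (v, u)).2) (fun v => (t (u, v)).1) (f u, s_in u, s_out u).
  by have := hs u; rewrite /f /s_in /s_out; case: (s u) => -[].
have fB u : f u \in B u by case: (hs u).
have outP u v : arc u v -> [/\ path arc (f u) (s_out u v),
    last (f u) (s_out u v) = (t (u, v)).1, uniq (f u :: s_out u v) &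
    {subset s_out u v <= B u}].
  by move=> uv; case: (hs u) => _ h _ _; apply: h; rewrite inE.
have inP u v : arc u v -> [/\ path (converse arc) (f v) (s_in v u),
    last (f v) (s_in v u) = (t (u, v)).2, uniq (f v :: s_in v u) &
    {subset s_in v u <= B v}].
  by move=> uv; case: (hs v) => _ _ h _; apply: h; rewrite inE.
pose P u v := s_out u v ++ rev (s_in v u).
have memP u v x : arc u v -> x \in P u v ->
    x \in s_out u v /\ x \in B u \/ x \in s_in v u /\ x \in B v.
  move=> uv; rewrite mem_cat mem_rev; have [_ _ _ oB] := outP u v uv.
  by have [_ _ _ iB] := inP u v uv; case/orP=> h; [left|right]; split; auto.
have inj_f : injective f by move=> u v e; apply: (disB u v (f u)); rewrite // e.
apply: (@contains_subdivision_paths f P) => // [u v uv|].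
  have [op ol ou oB] := outP u v uv; have [ip il iu iB] := inP u v uv.
  have erev : rcons (rev (s_in v u)) (f v) = rev (f v :: s_in v u) by rewrite rev_cons.
  have nuv : u != v by apply: contraTneq uv => ->; rewrite arc_irrefl.
  split.
  - rewrite /P rcons_cat cat_path op ol /= erev lastI rev_rcons /= il.
    rewrite -il rev_path ip andbT.
    by case: (ht (u, v)) => _ _ h; rewrite il; apply: h.
  - rewrite /P rcons_cat -cat_cons erev cat_uniq ou rev_uniq iu andbT /=.
    apply/hasPn => x; rewrite mem_rev => xv; apply/negP => xu.
    have xBv : x \in B v by move: xv; rewrite inE => /predU1P[->|/iB].
    have xBu : x \in B u by move: xu; rewrite inE => /predU1P[->|/oB].
    by move: nuv; rewrite (disB _ _ _ xBu xBv) eqxx.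
  - move=> x xP; apply/negP => /codomP[w ew].
    have xw : x \in B w by rewrite ew.
    case: (memP _ _ _ uv xP) => -[xs xB]; have eB := disB _ _ _ xB xw.
      by move: ou; rewrite /= eB -ew; move: xs; rewrite eB => ->.
    by move: iu; rewrite /= eB -ew; move: xs; rewrite eB => ->.
(* A common vertex lies in a single branch set, hence on two legs of one star, each outgoing or
   incoming. *)
move=> u v u' v' uv uv' ne x xP; apply/negP => xP'.
case: (memP _ _ _ uv xP) => -[xs xB]; case: (memP _ _ _ uv' xP') => -[xs' xB'];
  have eB := disB _ _ _ xB xB'.
- move: xs' uv' ne; rewrite -eB => xs' uv' ne.
  have nv : v != v' by apply/eqP => e; case: ne; rewrite e.
  have [_ _ _ [h _ _]] := hs u; have := h v v'; rewrite !inE => /(_ uv uv' nv).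
  by move/hasPn/(_ x xs')/negP.
- move: xs' uv' ne; rewrite -eB => xs' uv' ne.
  have [_ _ _ [_ _ h]] := hs u; have := h u' v; rewrite !inE => /(_ uv' uv).
  by move/hasPn/(_ x xs)/negP.
- move: xs' uv' ne; rewrite -eB => xs' uv' ne.
  have [_ _ _ [_ _ h]] := hs v; have := h u v'; rewrite !inE => /(_ uv uv').
  by move/hasPn/(_ x xs')/negP.
- move: xs' uv' ne; rewrite -eB => xs' uv' ne.
  have nv : u != u' by apply/eqP => e; case: ne; rewrite e.
  have [_ _ _ [_ h _]] := hs v; have := h u u'; rewrite !inE => /(_ uv uv' nv).
  by move/hasPn/(_ x xs')/negP.
Qed.

(** Each set added to the union has arcs to and from a set already in it. *)
Lemma strongly_connected_cover (S C : {set {set D}}) :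
  branch_family S -> grown (biadjacent arc) C -> C \subset S ->
  strongly_connected arc (cover C).
Proof.
move=> /and3P[_ _ /forall_inP cS]; elim=> [X|A Y Z _ IH ZA ZY].
  by rewrite sub1set => XS; rewrite /cover big_set1 cS.
rewrite subUset sub1set => /andP[YS AS].
have -> : cover (Y |: A) = Y :|: cover A.
  by rewrite /cover bigcup_setU big_set1.
have [_ [x [y [xZ yY xy]]] [x' [y' [xZ' yY' yx]]]] := biadjacentP _ _ _ ZY.
have ZC : Z \subset cover A by apply: (bigcup_sup Z).
apply: (strongly_connectedU (cS _ YS) (IH AS) yY' (subsetP ZC _ xZ') yx yY (subsetP ZC _ xZ) xy).
Qed.

End Embedding.

Theorem corollary2 (n : nat) (hn : 1 <= n) (D : digraph)
    (hD : 22 * n <= dichromatic_number D) (H : digraph)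
    (hH : subcubic H) (hcard : #|H| <= n) :
  contains_subdivision D H.
Proof.
have [asymH deg3 _ _] := subcubic_degrees hH.
(* Twice [11 * n - 1] is below [22 * n], and [11 * n - 1 <= 2 * dl + 1] will be the density that the
   minor requires. *)
have [|R [famR R0 degR]] := @dense_branch_family D (11 * n - 1).
  by apply: leq_trans hD; lia.
have [|S [dl [[famS S0] cS ddl degS]]] := dense_neighborhood _ famR R0 degR; first by lia.
have [|C [gC CS dC eC]] := dense_subcubic_minor (@biadjacent_sym _ arc)
  (@biadjacent_irrefl _ arc) asymH deg3 hn hcard cS _ degS S0; first by lia.
have [trS nS _] := and3P famS.
apply: (@contains_subdivision_minor _ _ (fun u => cover (C u))) => //.
- by move=> u; apply: strongly_connected_cover (gC u) (CS u).
- move=> u; have [X XC] := set0Pn _ (grown_neq0 (gC u)).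
  have [x xX] : exists x, x \in X.
    by apply/set0Pn; apply: contraNneq nS => <-; apply: (subsetP (CS u)).
  by apply/set0Pn; exists x; apply/bigcupP; exists X.
- move=> u v /dC dCuv; rewrite -setI_eq0; apply/eqP/setP => x; rewrite inE [RHS]inE.
  apply/negP => /andP[/bigcupP[X XC xX] /bigcupP[Y YC xY]].
  have XY : X != Y by apply: contraTneq YC => <-; rewrite (disjointFr dCuv XC).
  have := trivIsetP trS _ _ (subsetP (CS u) X XC) (subsetP (CS v) Y YC) XY.
  by move/disjointFr/(_ xX); rewrite xY.
- move=> u v /eC[X [Y [XC YC /biadjacentP[_ [x [y [xX yY xy]]] _]]]].
  exists x, y; split=> //; apply/bigcupP; [by exists X | by exists Y].
Qed.
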